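(* Let $\Delta^\tau<\Delta$, let $\pi$ be a policy for the $\Delta$-delayed task with Q-function $Q$, and $\pi^\tau$ a policy for the $\Delta^\tau$-delayed task with Q-function $Q^\tau$, and suppose $Q^\tau$ is $L_Q$-Lipschitz continuous. Then for every $x_t\in\mathcal X$, $$\mathbb E_{a_t\sim\pi(\cdot|x_t),\;x^\tau_t\sim b_\Delta(\cdot|x_t)}\big[Q^\tau(x^\tau_t,a_t)-Q(x_t,a_t)\big]\le\frac{\gamma L_Q}{1-\gamma}\,\mathbb E_{a_t\sim\pi(\cdot|x_t),\;x_{t+1}\sim\mathcal P_\Delta(\cdot|x_t,a_t),\;\hat x\sim d^\pi_{x_{t+1}},\;\hat x^\tau\sim b_\Delta(\cdot|\hat x)}\big[\mathcal W_1\big(\pi^\tau(\cdot|\hat x^\tau)\,\|\,\pi(\cdot|\hat x)\big)\big].$$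
   Context: Let $(\mathcal S,\mathcal A,\mathcal P,\mathcal R,\gamma)$ be an MDP with state space $\mathcal S$, action space $\mathcal A$ equipped with a metric $d_{\mathcal A}$, transition kernel $\mathcal P(\cdot|s,a)$, bounded reward $\mathcal R:\mathcal S\times\mathcal A\to\mathbb R$ and discount factor $\gamma\in(0,1)$. For a delay $\Delta\in\mathbb N$, the augmented state space is $\mathcal X=\mathcal S\times\mathcal A^\Delta$, with elements $x_t=(s_{t-\Delta},a_{t-\Delta},\dots,a_{t-1})$. The constant delayed MDP (CDMDP) with delay $\Delta$ has transition kernel $\mathcal P_\Delta(\cdot|x_t,a_t)$: the next augmented state is $x_{t+1}=(s_{t-\Delta+1},a_{t-\Delta+1},\dots,a_{t-1},a_t)$ with $s_{t-\Delta+1}\sim\mathcal P(\cdot|s_{t-\Delta},a_{t-\Delta})$; its reward is $\mathcal R_\Delta(x_t,a_t)=\mathbb E_{s_t\sim b(\cdot|x_t)}[\mathcal R(s_t,a_t)]$, where $b(\cdot|x_t)$ is the law of $s_t$ obtained from $s_{t-\Delta}$ by successively sampling $s_{t-\Delta+i+1}\sim\mathcal P(\cdot|s_{t-\Delta+i},a_{t-\Delta+i})$ for $i=0,\dots,\Delta-1$. For an auxiliary delay $\Delta^\tau\in\mathbb N$ with $\Delta^\tau<\Delta$, define analogously $\mathcal X^\tau=\mathcal S\times\mathcal A^{\Delta^\tau}$, the kernel $\mathcal P_{\Delta^\tau}$ and the reward $\mathcal R_\tau:=\mathcal R_{\Delta^\tau}$. The delayed belief $b_\Delta(\cdot|x_t)$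 is the distribution on $\mathcal X^\tau$ of $x^\tau_t=(s_{t-\Delta^\tau},a_{t-\Delta^\tau},\dots,a_{t-1})$, where the actions are copied from $x_t$ and $s_{t-\Delta^\tau}$ is obtained from $s_{t-\Delta}$ by successively sampling $s_{t-\Delta+i+1}\sim\mathcal P(\cdot|s_{t-\Delta+i},a_{t-\Delta+i})$ for $i=0,\dots,\Delta-\Delta^\tau-1$. A policy for the $\Delta$-delayed task is a Markov kernel $\pi(\cdot|x)$ on $\mathcal A$, $x\in\mathcal X$; its value functions $V(x)$, $Q(x,a)$ are the expected infinite-horizon discounted sums $\sum_{t\ge0}\gamma^t\mathcal R_\Delta(x_t,a_t)$ in the $\Delta$-CDMDP following $\pi$. A policy $\pi^\tau$ for the $\Delta^\tau$-delayed task is a kernel on $\mathcal A$ indexed by $\mathcal X^\tau$, with value functions $V^\tau,Q^\tau$ defined analogously in the $\Delta^\tau$-CDMDP with reward $\mathcal R_\tau$. $d^\pi_x(\cdot)=(1-\gamma)\sum_{i\ge0}\gamma^i\Pr(x_i\in\cdot\mid x_0=x)$ is the normalized discounted augmented-state visitation distribution under $\pi$ in the $\Delta$-CDMDP. ''$Q^\tau$ is $L_Q$-Lipschitz continuous'' means in particular $|Q^\tau(x^\tau,a_1)-Q^\tau(x^\tau,a_2)|\le L_Q\,d_{\mathcal A}(a_1,a_2)$ for all $x^\tau,a_1,a_2$. $\mathcal W_1$ is the $L^1$-Wasserstein distance on probability distributions on $\mathcal A$ with respect to $d_{\mathcal A}$. *)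

(* Defs.v *)
From HB Require Import structures.
From mathcomp Require Import all_boot all_order all_algebra.
From mathcomp Require Import all_classical all_reals all_analysis.
From mathcomp Require Import zify.

Set Implicit Arguments.
Unset Strict Implicit.
Unset Printing Implicit Defensive.

Import Order.TTheory GRing.Theory Num.Theory.
Local Open Scope classical_set_scope.
Local Open Scope ring_scope.

(** Augmented state space X_n = S x A^n.  An element x = (s, [:: a_0; ..; a_(n-1)])
    stands for (s_(t-n), a_(t-n), ..., a_(t-1)): index 0 is the OLDEST action. *)
Definition Xt d1 d2 (S : measurableType d1) (A : measurableType d2) (n : nat) :=
  (S * n.-tuple A)%type.

Section Delayed.
Context (R : realType) (d1 d2 : measure_display)
        (S : measurableType d1) (A : measurableType d2).

Local Open Scope ereal_scope.

Definition shift_buf n (t : n.-tuple A) (a : A) : n.-tuple A :=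
  behead_tuple (rcons_tuple t a).

Fixpoint rollE (P : R.-pker (S * A) ~> S) (f : S -> \bar R) (s : S)
    (acts : seq A) : \bar R :=
  match acts with
  | [::] => f s
  | a :: acts' => \int[P (s, a)]_s' rollE P f s' acts'
  end.

Definition rewardD (P : R.-pker (S * A) ~> S) (Rw : S * A -> R) n
    (x : Xt S A n) (a : A) : \bar R :=
  rollE P (fun s => (Rw (s, a))%:E) x.1 x.2.

Definition stepE (P : R.-pker (S * A) ~> S) n (g : Xt S A n -> \bar R)
    (x : Xt S A n) (a : A) : \bar R :=
  \int[P (x.1, head a x.2)]_s' g (s', shift_buf x.2 a).

Definition polStep (P : R.-pker (S * A) ~> S) n (pi : R.-pker (Xt S A n) ~> A)
    (g : Xt S A n -> \bar R) (x : Xt S A n) : \bar R :=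
  \int[pi x]_a stepE P g x a.

Fixpoint rstep (P : R.-pker (S * A) ~> S) (Rw : S * A -> R) n
    (pi : R.-pker (Xt S A n) ~> A) (k : nat) : Xt S A n -> A -> \bar R :=
  match k with
  | 0 => @rewardD P Rw n
  | k'.+1 => fun x a =>
      stepE P (fun x' => \int[pi x']_a' rstep P Rw pi k' x' a') x a
  end.

Definition Qfun (P : R.-pker (S * A) ~> S) (Rw : S * A -> R) (gamma : R) n
    (pi : R.-pker (Xt S A n) ~> A) (x : Xt S A n) (a : A) : \bar R :=
  \sum_(0 <= k <oo) ((gamma ^+ k)%:E * rstep P Rw pi k x a).

Definition occE (P : R.-pker (S * A) ~> S) (gamma : R) n
    (pi : R.-pker (Xt S A n) ~> A) (g : Xt S A n -> \bar R) (x : Xt S A n) : \bar R :=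
  ((1 - gamma)%:E * \sum_(0 <= i <oo) ((gamma ^+ i)%:E * iter i (polStep P pi) g x)).

Lemma belief_idx_proof (D Dt : nat) (h : (Dt <= D)%N) (i : 'I_Dt) :
  ((D - Dt) + i < D)%N.
Proof. have := ltn_ord i; lia. Qed.

Definition last_buf (D Dt : nat) (h : (Dt <= D)%N) (t : D.-tuple A) : Dt.-tuple A :=
  [tuple tnth t (Ordinal (belief_idx_proof h i)) | i < Dt].

(** Expectation of g(x^tau) for x^tau ~ b_D(.|x): the state s_(t-Dt) is obtained
    from s_(t-D) by rolling the first D-Dt actions, the actions are the last Dt ones. *)
Definition beliefE (P : R.-pker (S * A) ~> S) (D Dt : nat) (h : (Dt <= D)%N)
    (g : Xt S A Dt -> \bar R) (x : Xt S A D) : \bar R :=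
  rollE P (fun s => g (s, last_buf h x.2)) x.1 (take (D - Dt) x.2).

Definition couplings (mu nu : set A -> \bar R) : set (probability (A * A)%type R) :=
  [set c | forall B : set A, measurable B ->
     c (B `*` setT) = mu B /\ c (setT `*` B) = nu B].

Definition W1 (dA : A -> A -> R) (mu nu : set A -> \bar R) : \bar R :=
  ereal_inf [set \int[c]_p (dA p.1 p.2)%:E | c in couplings mu nu].

End Delayed.

Local Open Scope ring_scope.
Definition is_metric (T : Type) (R : realType) (d : T -> T -> R) : Prop :=
  [/\ forall x y, 0 <= d x y,
      forall x y, d x y = 0 <-> x = y,
      forall x y, d x y = d y x &
      forall x y z, d x z <= d x y + d y z].

(* Main.v *)
Require Import Defs.
From HB Require Import structures.
From mathcomp Require Import all_boot all_order all_algebra.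
From mathcomp Require Import all_classical all_reals all_analysis.
From mathcomp Require Import measurable_realfun.
From mathcomp Require Import ring lra.

Import Order.TTheory GRing.Theory Num.Theory numFieldNormedType.Exports.
Local Open Scope classical_set_scope.
Local Open Scope ring_scope.

Set Implicit Arguments.
Unset Strict Implicit.
Unset Printing Implicit Defensive.

(** Write U for one step of the Delta-CDMDP under pi, and J x for the belief
    average of V^tau at x minus V x.  The belief commutes with one step of the
    dynamics and averages R_tau to R_Delta, so the two Bellman equations give
    E_b[Q^tau(., a)] - Q(x, a) = gamma E[J(x_(t+1)) | x, a].  Hence the left-hand
    side is gamma (U J) x, and J = f + gamma U J where f x is the belief average of
    the integral of Q^tau against pi^tau minus its integral against pi.  Unrolling,
    J = sum_i gamma^i U^i f, and the easy half of Kantorovich duality bounds f by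
    L_Q times the belief average of W_1.

    Neither d_A nor W_1 is assumed measurable, so the integrals on the right-hand
    side are lower integrals, which are monotone but not additive.  All linear
    computations are therefore done on bounded measurable real functions (f, J),
    already divided by L_Q, and only monotonicity is used to compare them with
    the right-hand side. *)

(** * Bounded measurable functions *)

Definition bm {R : realType} {d} {T : measurableType d} (f : T -> R) :=
  measurable_fun setT f /\ exists M, forall x, `|f x| <= M.

Section BoundedMeasurable.
Context {R : realType} {d} {T : measurableType d}.
Implicit Types f g : T -> R.

Lemma bm_cst (c : R) : bm (fun _ : T => c).
Proof. by split; [exact: measurable_cst | exists `|c|]. Qed.

Lemma bmD f g : bm f -> bm g -> bm (fun x => f x + g x).
Proof.
move=> [mf [M fM]] [mg [N gN]]; split; first exact: measurable_funD.
by exists (M + N) => x; rewrite (le_trans (ler_normD _ _))// lerD.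
Qed.

Lemma bmZl (c : R) f : bm f -> bm (fun x => c * f x).
Proof.
move=> [mf [M fM]]; split; first exact: measurable_funM.
by exists (`|c| * M) => x; rewrite normrM ler_wpM2l.
Qed.

Lemma bmB f g : bm f -> bm g -> bm (fun x => f x - g x).
Proof.
move=> bf /(bmZl (-1)) bg; rewrite (_ : (fun _ => _) = fun x => f x + -1 * g x).
  exact: bmD.
by apply/funext => x; rewrite mulN1r.
Qed.

Lemma bm_comp d' (T' : measurableType d') (phi : T' -> T) f :
  measurable_fun setT phi -> bm f -> bm (fun x => f (phi x)).
Proof.
move=> mphi [mf [M fM]]; split; first exact: measurableT_comp.
by exists M.
Qed.

End BoundedMeasurable.

(** * Means of bounded functions under a measure of mass one *)

Section Mean.
Context {R : realType} {d} {T : measurableType d}.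
Variable mu : {measure set T -> \bar R}.
Hypothesis mu1 : mu setT = 1%E.
Implicit Types f g : T -> R.

Lemma bm_integrable f : bm f -> mu.-integrable setT (EFin \o f).
Proof.
move=> [mf [M fM]]; apply: measurable_bounded_integrable => //.
  by rewrite mu1 ltry.
exists M; split; first exact: num_real.
by move=> y My x _ /=; rewrite (le_trans (fM x))// ltW.
Qed.

Lemma mean_EFin f : bm f -> (\int[mu]_x (f x)%:E)%E = (\int[mu]_x f x)%:E.
Proof. by move=> bf; rewrite fineK//; apply/integrable_fin_num/bm_integrable. Qed.

Lemma meanD f g : bm f -> bm g ->
  \int[mu]_x (f x + g x) = \int[mu]_x f x + \int[mu]_x g x.
Proof. by move=> bf bg; rewrite RintegralD//; exact: bm_integrable. Qed.

Lemma meanZl c f : bm f -> \int[mu]_x (c * f x) = c * \int[mu]_x f x.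
Proof. by move=> bf; rewrite RintegralZl//; exact: bm_integrable. Qed.

Lemma meanB f g : bm f -> bm g ->
  \int[mu]_x (f x - g x) = \int[mu]_x f x - \int[mu]_x g x.
Proof. by move=> bf bg; rewrite RintegralB//; exact: bm_integrable. Qed.

Lemma mean_cst (c : R) : \int[mu]_x c = c.
Proof.
by have := @Rintegral_cst _ _ _ mu setT measurableT c; rewrite mu1 mulr1.
Qed.

Lemma ler_mean f g : bm f -> bm g -> (forall x, f x <= g x) ->
  \int[mu]_x f x <= \int[mu]_x g x.
Proof. by move=> bf bg fg; apply: le_Rintegral => //; exact: bm_integrable. Qed.

Lemma mean_bound f M : bm f -> (forall x, `|f x| <= M) ->
  `|\int[mu]_x f x| <= M.
Proof.
move=> bf fM; rewrite ler_norml; apply/andP; split.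
  rewrite -(mean_cst (- M)); apply: ler_mean => //; first exact: bm_cst.
  by move=> x; have := fM x; rewrite ler_norml => /andP[].
rewrite -[leRHS]mean_cst; apply: ler_mean => //; first exact: bm_cst.
by move=> x; exact: le_trans (ler_norm _) (fM x).
Qed.

End Mean.

Lemma pker1 {R : realType} {d1 d2} {X : measurableType d1}
  {Y : measurableType d2} (k : R.-pker X ~> Y) x : k x setT = 1%E.
Proof. exact: prob_kernel. Qed.

(** * Measurable dependence of kernel means on parameters *)

Section Pullback.
Context {R : realType} {d1 d2 d3} {X : measurableType d1} {Z : measurableType d2}
  {Y : measurableType d3}.
Variables (k : R.-pker Z ~> Y) (phi : X -> Z).
Hypothesis mphi : measurable_fun setT phi.

(** The proof argument lets the kernel instances below be inferred. *)
Definition kpull of measurable_fun setT phi := fun x : X => k (phi x).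

Let mkpull U : measurable U -> measurable_fun setT (kpull mphi ^~ U).
Proof.
move=> mU; apply: (measurableT_comp (f := k ^~ U)) => //.
exact: measurable_kernel.
Qed.

HB.instance Definition _ := isKernel.Build _ _ _ _ R (kpull mphi) mkpull.

Let kpull1 x : kpull mphi x setT = 1%E. Proof. exact: prob_kernel. Qed.

HB.instance Definition _ :=
  Kernel_isProbability.Build _ _ _ _ R (kpull mphi) kpull1.

(** Measurability of kernel integrals is known for nonnegative integrands, so the bound [M] is added
    to [h] first and subtracted from the mean afterwards; as [k] has mass one, this shifts every
    mean by exactly [M]. *)
Lemma bm_mean (h : X * Y -> R) : bm h ->
  bm (fun x => \int[k (phi x)]_y h (x, y)).
Proof.
move=> bh; have [mh [M hM]] := bh.
have bhx x : bm (fun y => h (x, y)).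
  by apply: (bm_comp (f := h)) => //; exact: pair1_measurable.
split; last by exists M => x; apply: mean_bound => //; exact: pker1.
pose h' p := (h p + M)%:E.
have h'0 p : (0 <= h' p)%E.
  by rewrite lee_fin; have := hM p; rewrite ler_norml => /andP[]; lra.
have mh' : measurable_fun setT h'.
  by apply/measurable_EFinP; apply: measurable_funD.
have := measurable_fun_integral_finite_kernel h' (kpull mphi) h'0 mh'.
rewrite (_ : (fun _ => _) = EFin \o (fun x => \int[k (phi x)]_y h (x, y) + M)).
  move=> /measurable_EFinP mhM.
  rewrite (_ : (fun _ => _) = fun x => (\int[k (phi x)]_y h (x, y) + M) - M).
    exact: measurable_funB.
  by apply/funext => x; rewrite addrK.
apply/funext => x /=; have k1 := pker1 k (phi x).
rewrite /h' mean_EFin//; last by apply: bmD => //; exact: bm_cst.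
by rewrite meanD//; [rewrite mean_cst | exact: bm_cst].
Qed.

End Pullback.

(** * Exchanging the order of two means *)

Section AsProbability.
Context {R : realType} {d} {T : measurableType d}.
Variables (mu : {measure set T -> \bar R}) (mu1 : mu setT = 1%E).

(** Carrying the proof of mass one makes the probability instance inferable. *)
Definition asprob of mu setT = 1%E : set T -> \bar R := mu.

HB.instance Definition _ := Measure.on (asprob mu1).
HB.instance Definition _ :=
  Measure_isProbability.Build _ _ R (asprob mu1) mu1.

End AsProbability.

(** Tonelli for the nonnegative function [h + M]; both iterated means are shifted by the same [M],
    which cancels. *)
Lemma mean_swap {R : realType} {d1 d2 d3 d4} {Z1 : measurableType d1}
    {X : measurableType d2} {Z2 : measurableType d3} {Y : measurableType d4}
    (k1 : R.-pker Z1 ~> X) (k2 : R.-pker Z2 ~> Y) z1 z2 (h : X * Y -> R) :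
  bm h ->
  \int[k1 z1]_x \int[k2 z2]_y h (x, y) = \int[k2 z2]_y \int[k1 z1]_x h (x, y).
Proof.
move=> bh; have [mh [M hM]] := bh.
have b1 x : bm (fun y => h (x, y)).
  by apply: (bm_comp (f := h)) => //; exact: pair1_measurable.
have b2 y : bm (fun x => h (x, y)).
  by apply: (bm_comp (f := h)) => //; exact: pair2_measurable.
have B1 : bm (fun x => \int[k2 z2]_y h (x, y)).
  exact: (bm_mean k2 (@measurable_cst _ _ _ _ _ z2)).
have B2 : bm (fun y => \int[k1 z1]_x h (x, y)).
  apply: (bm_mean k1 (@measurable_cst _ _ _ _ _ z1) (h := fun p => h (p.2, p.1))).
  apply: (bm_comp (phi := fun p => (p.2, p.1))) bh.
  exact: measurable_fun_pair.
pose h' p := (h p + M)%:E.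
have h'0 p : (0 <= h' p)%E.
  by rewrite lee_fin; have := hM p; rewrite ler_norml => /andP[]; lra.
have mh' : measurable_fun setT h'.
  by apply/measurable_EFinP; apply: measurable_funD.
have : (\int[k1 z1]_x \int[k2 z2]_y h' (x, y) =
        \int[k2 z2]_y \int[k1 z1]_x h' (x, y))%E.
  exact: (fubini_tonelli (m1 := asprob (pker1 k1 z1))
                         (m2 := asprob (pker1 k2 z2))).
have E1 x : (\int[k2 z2]_y h' (x, y))%E = (\int[k2 z2]_y h (x, y) + M)%:E.
  rewrite /h' (mean_EFin (pker1 k2 z2)); last by apply: bmD => //; exact: bm_cst.
  by rewrite (meanD (pker1 _ _))// ?(mean_cst (pker1 _ _))//; exact: bm_cst.
have E2 y : (\int[k1 z1]_x h' (x, y))%E = (\int[k1 z1]_x h (x, y) + M)%:E.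
  rewrite /h' (mean_EFin (pker1 k1 z1)); last by apply: bmD => //; exact: bm_cst.
  by rewrite (meanD (pker1 _ _))// ?(mean_cst (pker1 _ _))//; exact: bm_cst.
under eq_integral do rewrite E1.
under [in RHS]eq_integral do rewrite E2.
rewrite (mean_EFin (pker1 k1 z1)); last by apply: bmD => //; exact: bm_cst.
rewrite (mean_EFin (pker1 k2 z2)); last by apply: bmD => //; exact: bm_cst.
rewrite !(meanD (pker1 _ _))// ?(mean_cst (pker1 _ _)); try exact: bm_cst.
by move=> [/addIr].
Qed.

(** No measurability is needed: the integral of the positive (resp. negative)
    part is by definition a supremum over the simple functions below it. *)
Lemma le_integral_pointwise {R : realType} {d} {T : measurableType d}
    (mu : {measure set T -> \bar R}) (f g : T -> \bar R) :
  (forall x, f x <= g x)%E -> (\int[mu]_x f x <= \int[mu]_x g x)%E.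
Proof.
move=> fg; rewrite /integral !patch_setT; apply: leeB; apply: ereal_sup_le;
  move=> _ [h hf <-]; exists h => //= x; apply: le_trans (hf x) _.
- by rewrite !funeposE ge_max le_max fg /= le_max lexx orbT.
- by rewrite !funenegE ge_max le_max leeN2 fg /= le_max lexx orbT.
Qed.

(** * Rolling the state forward along a list of actions *)

Section Roll.
Context {R : realType} {d1 d2} {S : measurableType d1} {A : measurableType d2}.
Variable P : R.-pker (S * A) ~> S.

Fixpoint rollR (f : S -> R) (s : S) (acts : seq A) : R :=
  match acts with
  | [::] => f s
  | a :: acts' => \int[P (s, a)]_s' rollR f s' acts'
  end.

(** The actions are measurable maps indexed by a fixed list, so that they vary with [w] while the
    number of transitions does not. The induction enlarges the parameter space: after one transition
    the sampled state is a new coordinate of [W * S], and rolling restarts from it. *)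
Lemma bm_rollR_param I (r : seq I) : forall d (W : measurableType d)
    (f : W * S -> R) (sg : W -> S) (al : I -> W -> A),
  bm f -> measurable_fun setT sg -> (forall i, measurable_fun setT (al i)) ->
  bm (fun w => rollR (fun s => f (w, s)) (sg w) [seq al i w | i <- r]).
Proof.
elim: r => [|i r IH] d W f sg al bf msg mal /=.
  apply: (bm_comp (phi := fun w => (w, sg w))) bf.
  exact: measurable_fun_pair.
apply: (bm_mean P (phi := fun w => (sg w, al i w))
   _ (h := fun p => rollR (fun s => f (p.1, s)) p.2 [seq al i p.1 | i <- r])).
  exact: measurable_fun_pair.
apply: (IH _ _ (fun q => f (q.1.1, q.2)) snd (fun i p => al i p.1)) => //.
- apply: (bm_comp (phi := fun q : W * S * S => (q.1.1, q.2))) bf.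
  by apply: measurable_fun_pair => //; exact: measurableT_comp.
- by move=> j; exact: measurableT_comp.
Qed.

Lemma bm_rollR_buf n k d (W : measurableType d)
    (f : W * S -> R) (sg : W -> S) (buf : W -> n.-tuple A) :
  bm f -> measurable_fun setT sg -> measurable_fun setT buf ->
  bm (fun w => rollR (fun s => f (w, s)) (sg w) (take k (buf w))).
Proof.
move=> bf msg mbuf.
(* The first [k] entries of a tuple are its coordinate maps at the first [k] indices. *)
have := @bm_rollR_param _ (take k (enum 'I_n)) _ _ f sg
  (fun i w => tnth (buf w) i) bf msg.
rewrite (_ : (fun w => rollR _ (sg w) _) =
  fun w => rollR (fun s => f (w, s)) (sg w) (take k (buf w))).
  move=> H; apply: H => i; apply: (measurableT_comp (f := fun t => tnth t i)) => //.
  exact: measurable_tnth.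
by apply/funext => w; rewrite map_take map_tnth_enum.
Qed.

Lemma bm_rollR f l : bm f -> bm (fun s => rollR f s l).
Proof.
elim: l => [//|a l IH] /= bf.
apply: (bm_mean P (phi := fun s => (s, a)) _ (h := fun p => rollR f p.2 l)) => //.
exact: (bm_comp measurable_snd (IH bf)).
Qed.

Lemma rollE_EFin f s l : bm f -> rollE P (fun s => (f s)%:E) s l = (rollR f s l)%:E.
Proof.
move=> bf; elim: l s => [//|a l IH] s /=.
under eq_integral do rewrite IH.
by rewrite (mean_EFin (pker1 _ _))//; exact: bm_rollR.
Qed.

Lemma rollRB f g s l : bm f -> bm g ->
  rollR (fun s => f s - g s) s l = rollR f s l - rollR g s l.
Proof.
move=> bf bg; elim: l s => [//|a l IH] s /=.
under eq_Rintegral do rewrite IH.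
by rewrite (meanB (pker1 _ _))//; exact: bm_rollR.
Qed.

Lemma rollRD f g s l : bm f -> bm g ->
  rollR (fun s => f s + g s) s l = rollR f s l + rollR g s l.
Proof.
move=> bf bg; elim: l s => [//|a l IH] s /=.
under eq_Rintegral do rewrite IH.
by rewrite (meanD (pker1 _ _))//; exact: bm_rollR.
Qed.

Lemma rollRZ c f s l : bm f -> rollR (fun s => c * f s) s l = c * rollR f s l.
Proof.
move=> bf; elim: l s => [//|a l IH] s /=.
under eq_Rintegral do rewrite IH.
by rewrite (meanZl (pker1 _ _))//; exact: bm_rollR.
Qed.

Lemma rollR_cst c s l : rollR (fun=> c) s l = c.
Proof.
elim: l s => [//|a l IH] s /=.
by under eq_Rintegral do rewrite IH; rewrite (mean_cst (pker1 _ _)).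
Qed.

Lemma rollR_cat f s l1 l2 :
  rollR f s (l1 ++ l2) = rollR (fun s' => rollR f s' l2) s l1.
Proof.
elim: l1 s => [//|a l IH] s /=.
by under eq_Rintegral do rewrite IH.
Qed.

Lemma rollR_swap d3 d4 (Z : measurableType d3) (Y : measurableType d4)
    (k : R.-pker Z ~> Y) z (h : Y * S -> R) s l : bm h ->
  \int[k z]_y rollR (fun s => h (y, s)) s l =
  rollR (fun s => \int[k z]_y h (y, s)) s l.
Proof.
move=> bh; elim: l s => [//|a l IH] s /=.
(* Only the first transition is exchanged with [k z]; the induction hypothesis handles the later
   ones. *)
transitivity (\int[P (s, a)]_s' \int[k z]_y rollR (fun s => h (y, s)) s' l).
  apply: (mean_swap k P z (s, a) (h := fun p => rollR (fun s => h (p.1, s)) p.2 l)).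
  (* The list [l] indexes itself: each of its actions is a constant map of the parameter. *)
  have := @bm_rollR_param _ l _ _ (fun q : (Y * S) * S => h (q.1.1, q.2))
    snd (fun a _ => a).
  rewrite (_ : (fun w => rollR _ _ [seq _ | _ <- _]) =
    fun w => rollR (fun s => h (w.1, s)) w.2 l).
    move=> H; apply: H => //.
    apply: (bm_comp (phi := fun q : Y * S * S => (q.1.1, q.2))) bh.
    by apply: measurable_fun_pair => //; exact: measurableT_comp.
  by apply/funext => w; rewrite map_id.
by under eq_Rintegral do rewrite IH.
Qed.

Lemma le_rollE (f g : S -> \bar R) s l : (forall s, f s <= g s)%E ->
  (rollE P f s l <= rollE P g s l)%E.
Proof.
move=> fg; elim: l s => [//|a l IH] s /=.
by apply: le_integral_pointwise => s'; exact: IH.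
Qed.

End Roll.

(** * The action buffer and one transition of the delayed dynamics *)

Section Buffer.
Context {R : realType} {d1 d2} {S : measurableType d1} {A : measurableType d2}.
Variable P : R.-pker (S * A) ~> S.

(** For [n = 0] the buffer is empty and [head] returns its default, the current action: without
    delay it is this action that drives the transition. *)
Lemma measurable_head n :
  measurable_fun setT (fun p : A * n.-tuple A => head p.1 p.2).
Proof.
case: n => [|n].
  rewrite (_ : (fun _ => _) = fst) //.
  by apply/funext => -[a t] /=; rewrite tuple0.
rewrite (_ : (fun _ => _) = (fun t => tnth t ord0) \o snd).
  by apply: measurableT_comp => //; exact: measurable_tnth.
by apply/funext => -[a t] /=; rewrite (tnth_nth a) nth0.
Qed.

(** Coordinatewise: entry [i] of the shifted buffer is entry [i.+1] of the old one, except the last,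
    which is the appended action. *)
Lemma measurable_shift_buf n :
  measurable_fun setT (fun p : n.-tuple A * A => shift_buf p.1 p.2).
Proof.
apply/measurable_fun_tnthP => i.
have [lin|nin] := ltnP i.+1 n.
  rewrite (_ : _ \o _ = (fun t => tnth t (Ordinal lin)) \o fst).
    by apply: measurableT_comp => //; exact: measurable_tnth.
  apply/funext => -[t a] /=.
  by rewrite !(tnth_nth a) /= nth_behead nth_rcons size_tuple lin.
rewrite (_ : _ \o _ = snd) //.
apply/funext => -[t a] /=.
rewrite (tnth_nth a) /= nth_behead nth_rcons size_tuple ltnNge nin /=.
by case: ifP.
Qed.

Definition stepR n (g : Xt S A n -> R) (x : Xt S A n) (a : A) : R :=
  \int[P (x.1, head a x.2)]_s' g (s', shift_buf x.2 a).

Lemma bm_stepR n (g : Xt S A n -> R) : bm g ->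
  bm (fun p : Xt S A n * A => stepR g p.1 p.2).
Proof.
move=> bg.
apply: (bm_mean P (phi := fun p : Xt S A n * A => (p.1.1, head p.2 p.1.2))
  _ (h := fun q : Xt S A n * A * S => g (q.2, shift_buf q.1.1.2 q.1.2))).
  apply: measurable_fun_pair; first exact: measurableT_comp.
  apply: (measurableT_comp (f := fun p : A * n.-tuple A => head p.1 p.2)
    (g := fun p : Xt S A n * A => (p.2, p.1.2))).
    exact: measurable_head.
  by apply: measurable_fun_pair => //; exact: measurableT_comp.
apply: (bm_comp (phi := fun q : Xt S A n * A * S =>
   (q.2, shift_buf q.1.1.2 q.1.2))) bg.
apply: measurable_fun_pair => //.
apply: (measurableT_comp (f := fun p : n.-tuple A * A => shift_buf p.1 p.2)
    (g := fun q : Xt S A n * A * S => (q.1.1.2, q.1.2))).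
  exact: measurable_shift_buf.
apply: measurable_fun_pair; last exact: measurableT_comp.
by apply: measurableT_comp => //; exact: measurableT_comp.
Qed.

End Buffer.

(** * Discounted series and their tails *)

Section Discounting.
Context {R : realType}.
Variable gamma : R.
Hypothesis gamma01 : 0 < gamma < 1.

(** The right-hand side tends to 0. This is how truncation errors of order [gamma ^+ n] are removed,
    both in the Bellman equation and in the unrolling of J. *)
Lemma le0_geometric (C x : R) : (forall n, x <= C * gamma ^+ n) -> x <= 0.
Proof.
move=> xC; have /andP[g0 g1] := gamma01.
have cC : C * gamma ^+ n @[n --> \oo] --> C * 0.
  by apply: cvgMl_tmp; apply: cvg_expr; rewrite ger0_norm// ltW.
rewrite -(mulr0 C) -(cvg_lim _ cC)//.
apply: limr_ge; first by apply/cvg_ex; exists (C * 0).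
exact: nearW.
Qed.

Variables (u : R^nat) (M : R).
Hypothesis uM : forall k, `|u k| <= M.

Lemma is_cvg_discounted : cvgn (series (fun k => gamma ^+ k * u k)).
Proof.
have /andP[g0 g1] := gamma01.
apply: normed_cvg; apply: (@series_le_cvg _ _ (geometric M gamma)) => //.
- by move=> n; exact: normr_ge0.
- by move=> n; rewrite /geometric /= mulr_ge0//;
    [exact: le_trans (uM 0%N) | rewrite exprn_ge0// ltW].
- move=> n; rewrite /geometric /= normrM mulrC.
  by rewrite (ger0_norm (exprn_ge0 _ (ltW g0))) ler_wpM2r// exprn_ge0// ltW.
- by apply: is_cvg_geometric_series; rewrite ger0_norm// ltW.
Qed.

Lemma nneseries_discounted :
  (\sum_(0 <= k <oo) (gamma ^+ k * u k)%:E)%E =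
  (limn (series (fun k => gamma ^+ k * u k)))%:E.
Proof.
rewrite -EFin_lim; last exact: is_cvg_discounted.
by congr (limn _); apply/funext => n /=; rewrite /series /= sumEFin.
Qed.

Lemma discounted_tail n :
  `|limn (series (fun k => gamma ^+ k * u k)) -
    \sum_(0 <= k < n) gamma ^+ k * u k| <= M / (1 - gamma) * gamma ^+ n.
Proof.
have /andP[g0 g1] := gamma01.
pose s := series (fun k => gamma ^+ k * u k).
have M0 : 0 <= M by exact: le_trans (uM 0).
have g10 : 1 - gamma != 0 by rewrite subr_eq0 eq_sym lt_eqF.
have C0 : 0 <= M / (1 - gamma) by rewrite divr_ge0// subr_ge0 ltW.
(* The geometric sum of [M * gamma ^+ k] for k from n to n + m - 1, in the closed form that makes
   the induction on [m] a field identity. *)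
have sn m : `|s (n + m)%N - s n| <= M / (1 - gamma) * (gamma ^+ n - gamma ^+ (n + m)).
  elim: m => [|m IH]; first by rewrite addn0 !subrr normr0 mulr0.
  rewrite addnS {1}/s /series /= big_nat_recr//= -/(series _ _) -/s.
  rewrite addrAC (le_trans (ler_normD _ _))//.
  rewrite normrM (ger0_norm (exprn_ge0 _ (ltW g0))).
  rewrite (_ : _ * (_ - _) = M / (1 - gamma) * (gamma ^+ n - gamma ^+ (n + m))
     + gamma ^+ (n + m) * M); last by rewrite exprS; field.
  by rewrite lerD// ler_wpM2l// exprn_ge0// ltW.
have {}sn m : (n <= m)%N -> `|s m - s n| <= M / (1 - gamma) * gamma ^+ n.
  move=> /subnKC <-; rewrite (le_trans (sn _))// ler_wpM2l// lerBlDr lerDl.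
  by rewrite exprn_ge0// ltW.
have cs := is_cvg_discounted.
rewrite -/(s n) ler_norml lerBrDr lerBlDr; apply/andP; split.
  apply: limr_ge => //; near=> m.
  have : (n <= m)%N by near: m; exact: nbhs_infty_ge.
  by move=> /sn; rewrite ler_norml lerBrDr => /andP[].
apply: limr_le => //; near=> m.
have : (n <= m)%N by near: m; exact: nbhs_infty_ge.
by move=> /sn; rewrite ler_norml lerBlDr => /andP[].
Unshelve. all: by end_near.
Qed.

End Discounting.

(** * Real-valued Q-functions and the Bellman equation *)

Section ValueFunctions.
Context {R : realType} {d1 d2} {S : measurableType d1} {A : measurableType d2}.
Variables (P : R.-pker (S * A) ~> S) (Rw : S * A -> R) (gamma : R).
Hypotheses (bRw : bm Rw) (gamma01 : 0 < gamma < 1).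
Variables (n : nat) (pi : R.-pker (Xt S A n) ~> A).
Implicit Types (h : Xt S A n -> A -> R) (x : Xt S A n) (a : A).

Definition avgR h x := \int[pi x]_a h x a.

Definition nextR h x a := stepR P (avgR h) x a.

Definition rewardR x a := rollR P (fun s => Rw (s, a)) x.1 x.2.

Fixpoint rstepR k : Xt S A n -> A -> R :=
  if k is k'.+1 then nextR (rstepR k') else rewardR.

Definition QR x a := limn (series (fun k => gamma ^+ k * rstepR k x a)).

Lemma bm_section h x : bm (fun p => h p.1 p.2) -> bm (h x).
Proof. by move=> bh; exact: (bm_comp (pair1_measurable x) bh). Qed.

Lemma bm_avgR h : bm (fun p => h p.1 p.2) -> bm (avgR h).
Proof.
exact: (bm_mean pi (phi := id) _ (h := fun p => h p.1 p.2)).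
Qed.

Lemma bm_step_section (g : Xt S A n -> R) x a :
  bm g -> bm (fun s => g (s, shift_buf x.2 a)).
Proof. by move=> bg; apply: (bm_comp (phi := pair^~ _)) bg. Qed.

Lemma stepRB (g1 g2 : Xt S A n -> R) x a : bm g1 -> bm g2 ->
  stepR P (fun y => g1 y - g2 y) x a = stepR P g1 x a - stepR P g2 x a.
Proof.
by move=> b1 b2; rewrite /stepR (meanB (pker1 _ _))//; exact: bm_step_section.
Qed.

Lemma stepRD (g1 g2 : Xt S A n -> R) x a : bm g1 -> bm g2 ->
  stepR P (fun y => g1 y + g2 y) x a = stepR P g1 x a + stepR P g2 x a.
Proof.
by move=> b1 b2; rewrite /stepR (meanD (pker1 _ _))//; exact: bm_step_section.
Qed.

Lemma stepRZ c (g : Xt S A n -> R) x a : bm g ->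
  stepR P (fun y => c * g y) x a = c * stepR P g x a.
Proof.
by move=> b; rewrite /stepR (meanZl (pker1 _ _))//; exact: bm_step_section.
Qed.

Lemma avgRB h1 h2 x : bm (fun p => h1 p.1 p.2) -> bm (fun p => h2 p.1 p.2) ->
  avgR (fun y a => h1 y a - h2 y a) x = avgR h1 x - avgR h2 x.
Proof.
by move=> b1 b2; rewrite /avgR (meanB (pker1 _ _))//; exact: bm_section.
Qed.

Lemma avgRD h1 h2 x : bm (fun p => h1 p.1 p.2) -> bm (fun p => h2 p.1 p.2) ->
  avgR (fun y a => h1 y a + h2 y a) x = avgR h1 x + avgR h2 x.
Proof.
by move=> b1 b2; rewrite /avgR (meanD (pker1 _ _))//; exact: bm_section.
Qed.

Lemma avgRZ c h x : bm (fun p => h p.1 p.2) ->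
  avgR (fun y a => c * h y a) x = c * avgR h x.
Proof. by move=> b; rewrite /avgR (meanZl (pker1 _ _))//; exact: bm_section. Qed.

Lemma bm_nextR h : bm (fun p => h p.1 p.2) -> bm (fun p => nextR h p.1 p.2).
Proof. by move=> /bm_avgR; exact: bm_stepR. Qed.

Lemma nextRD h1 h2 x a : bm (fun p => h1 p.1 p.2) -> bm (fun p => h2 p.1 p.2) ->
  nextR (fun y a => h1 y a + h2 y a) x a = nextR h1 x a + nextR h2 x a.
Proof.
move=> b1 b2; rewrite -stepRD; [|exact: bm_avgR..].
by congr (stepR _ _ _ _); apply/funext => y; exact: avgRD.
Qed.

Lemma nextRZ c h x a : bm (fun p => h p.1 p.2) ->
  nextR (fun y a => c * h y a) x a = c * nextR h x a.
Proof.
move=> b; rewrite -stepRZ; last exact: bm_avgR.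
by congr (stepR _ _ _ _); apply/funext => y; exact: avgRZ.
Qed.

Lemma nextRB h1 h2 x a : bm (fun p => h1 p.1 p.2) -> bm (fun p => h2 p.1 p.2) ->
  nextR (fun y a => h1 y a - h2 y a) x a = nextR h1 x a - nextR h2 x a.
Proof.
move=> b1 b2; rewrite -stepRB; [|exact: bm_avgR..].
by congr (stepR _ _ _ _); apply/funext => y; exact: avgRB.
Qed.

Lemma avgR_bound h M x : bm (fun p => h p.1 p.2) ->
  (forall y a, `|h y a| <= M) -> `|avgR h x| <= M.
Proof.
by move=> bh hM; apply: mean_bound; [exact: pker1|exact: bm_section|].
Qed.

Lemma stepR_bound (g : Xt S A n -> R) M x a : bm g ->
  (forall y, `|g y| <= M) -> `|stepR P g x a| <= M.
Proof.
by move=> bg gM; apply: mean_bound; [exact: pker1|exact: bm_step_section|].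
Qed.

Lemma nextR_bound h M x a : bm (fun p => h p.1 p.2) ->
  (forall y a, `|h y a| <= M) -> `|nextR h x a| <= M.
Proof.
by move=> bh hM; apply: stepR_bound => [|y]; [exact: bm_avgR|exact: avgR_bound].
Qed.

Lemma bm_rewardR : bm (fun p => rewardR p.1 p.2).
Proof.
have := @bm_rollR_buf _ _ _ _ _ P n n _ _
  (fun q : (Xt S A n * A) * S => Rw (q.2, q.1.2)) (fun p => p.1.1) (fun p => p.1.2).
rewrite (_ : (fun w => rollR _ _ _ _) = fun p => rewardR p.1 p.2).
  move=> H; apply: H.
  - apply: (bm_comp (phi := fun q : Xt S A n * A * S => (q.2, q.1.2))) bRw.
    by apply: measurable_fun_pair => //; exact: measurableT_comp.
  - exact: measurableT_comp.
  - exact: measurableT_comp.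
by apply/funext => w; rewrite take_oversize// size_tuple.
Qed.

Lemma bm_rstepR k : bm (fun p => rstepR k p.1 p.2).
Proof. by elim: k => [|k IH]; [exact: bm_rewardR|exact: bm_nextR]. Qed.

(** Averaging against probability kernels does not enlarge a uniform bound, so a bound on the
    delayed reward serves every [k]. *)
Lemma rstepR_bounded : exists M, forall k x a, `|rstepR k x a| <= M.
Proof.
have [_ [M rM]] := bm_rewardR; exists M; elim=> [|k IH] x a /=.
  exact: (rM (x, a)).
by apply: nextR_bound => //; exact: bm_rstepR.
Qed.

Lemma stepE_EFin (g : Xt S A n -> R) x a : bm g ->
  stepE P (fun y => (g y)%:E) x a = (stepR P g x a)%:E.
Proof.
by move=> bg; rewrite /stepE (mean_EFin (pker1 _ _))//; exact: bm_step_section.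
Qed.

Lemma rstep_EFin k x a : rstep P Rw pi k x a = (rstepR k x a)%:E.
Proof.
elim: k x a => [|k IH] x a /=.
  rewrite /rewardD rollE_EFin//.
  by apply: (bm_comp (phi := pair^~ a)) bRw.
rewrite -stepE_EFin; last exact/bm_avgR/bm_rstepR.
congr (stepE _ _ _ _); apply/funext => y.
under eq_integral do rewrite IH.
by rewrite (mean_EFin (pker1 _ _))//; apply: bm_section; exact: bm_rstepR.
Qed.

Lemma Qfun_EFin x a : Qfun P Rw gamma pi x a = (QR x a)%:E.
Proof.
have [M rM] := rstepR_bounded.
rewrite /QR -(nneseries_discounted gamma01 (fun k => rM k x a)).
by apply: eq_eseriesr => k _; rewrite rstep_EFin EFinM.
Qed.

Definition QRn m x a := \sum_(0 <= k < m) gamma ^+ k * rstepR k x a.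

Lemma QRnS m x a : QRn m.+1 x a = QRn m x a + gamma ^+ m * rstepR m x a.
Proof. by rewrite /QRn big_nat_recr. Qed.

Lemma bm_QRn m : bm (fun p => QRn m p.1 p.2).
Proof.
elim: m => [|m IH]; first rewrite /QRn.
  by under eq_fun do rewrite big_geq//; exact: bm_cst.
under eq_fun do rewrite QRnS.
by apply: bmD => //; apply: bmZl; exact: bm_rstepR.
Qed.

Lemma QR_QRn : exists C, forall m x a, `|QR x a - QRn m x a| <= C * gamma ^+ m.
Proof.
have [M rM] := rstepR_bounded; exists (M / (1 - gamma)) => m x a.
exact: discounted_tail.
Qed.

Lemma bm_QR : bm (fun p => QR p.1 p.2).
Proof.
have [M rM] := rstepR_bounded; split.
  apply: (measurable_fun_cvg (h := fun m p => QRn m p.1 p.2)).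
    by move=> m; have [] := bm_QRn m.
  move=> [x a] _ /=; exact: (is_cvg_discounted gamma01 (fun k => rM k x a)).
(* At horizon 0 the truncation vanishes, and the tail estimate becomes a bound on [QR] itself. *)
have [C QC] := QR_QRn; exists C => -[x a] /=.
by have := QC 0 x a; rewrite /QRn big_geq// subr0 expr0 mulr1.
Qed.

(** The Bellman equation at finite horizon, where linearity of [nextR] suffices: summand [m.+1] is
    [gamma] times [nextR] of summand [m]. *)
Lemma nextR_QRn m x a : QRn m.+1 x a = rewardR x a + gamma * nextR (QRn m) x a.
Proof.
elim: m => [|m IH].
  rewrite /QRn big_nat1 expr0 mul1r /=.
  suff -> : nextR (QRn 0) x a = 0 by rewrite mulr0 addr0.
  (* The zero function is written as a multiple of the reward so that homogeneity of [nextR]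
     applies. *)
  rewrite (_ : QRn 0 = fun y b => 0 * rewardR y b).
    by rewrite nextRZ ?mul0r//; exact: bm_rewardR.
  by apply/funext => y; apply/funext => b; rewrite mul0r /QRn big_geq.
rewrite QRnS IH.
rewrite [in RHS](_ : QRn m.+1 = fun y b => QRn m y b + gamma ^+ m * rstepR m y b).
  rewrite nextRD; [|exact: bm_QRn|exact/bmZl/bm_rstepR].
  rewrite nextRZ; last exact: bm_rstepR.
  by rewrite [rstepR m.+1]/= mulrDr addrA mulrA -exprS.
by apply/funext => y; apply/funext => b; exact: QRnS.
Qed.

(** The finite-horizon equation is exact, so the defect consists of two truncation errors, one of
    them under [nextR], which preserves uniform bounds. Each is at most [C * gamma ^+ m] for every
    [m]. *)
Lemma bellman x a : QR x a = rewardR x a + gamma * nextR QR x a.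
Proof.
have /andP[g0 g1] := gamma01.
have [C QC] := QR_QRn.
apply/eqP; rewrite -subr_eq0 -normr_le0.
apply: (le0_geometric gamma01 (C := C + C)) => m.
have C0 : 0 <= C * gamma ^+ m by exact: le_trans (QC m x a).
have TC : `|nextR QR x a - nextR (QRn m) x a| <= C * gamma ^+ m.
  rewrite -nextRB; [|exact: bm_QR|exact: bm_QRn].
  apply: nextR_bound => //; apply: bmB; [exact: bm_QR|exact: bm_QRn].
rewrite (_ : _ - _ = (QR x a - QRn m.+1 x a) -
   gamma * (nextR QR x a - nextR (QRn m) x a)); last by rewrite nextR_QRn; ring.
rewrite (le_trans (ler_normB _ _))// mulrDl lerD//.
  rewrite (le_trans (QC _ _ _))// exprS mulrCA ler_piMl// ltW//.
by rewrite normrM (ger0_norm (ltW g0)) (le_trans (ler_piMl _ _))// ltW.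
Qed.

End ValueFunctions.

(** * The delayed belief and its commutation with the dynamics *)

Section Belief.
Context {R : realType} {d1 d2} {S : measurableType d1} {A : measurableType d2}.
Variables (P : R.-pker (S * A) ~> S) (D Dt : nat) (hD : (Dt <= D)%N).

Lemma val_last_buf (t : D.-tuple A) : last_buf hD t = drop (D - Dt) t :> seq A.
Proof.
case: Dt hD => [|m] h.
  by rewrite tuple0 drop_oversize// size_tuple subn0.
(* A default for [nth]; the buffer is nonempty because the auxiliary delay is positive here. *)
pose a0 := tnth t (Ordinal (belief_idx_proof h ord0)).
apply: (@eq_from_nth _ a0); first by rewrite size_drop !size_tuple subKn.
move=> i; rewrite size_tuple => im.
rewrite -[i]/(nat_of_ord (Ordinal im)) -tnth_nth tnth_mktuple.
by rewrite (tnth_nth a0) nth_drop.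
Qed.

Lemma last_buf_shift (t : D.-tuple A) a :
  last_buf hD (shift_buf t a) = shift_buf (last_buf hD t) a.
Proof.
apply: val_inj; rewrite /= val_last_buf /= val_last_buf -!drop1.
by rewrite -drop_rcons ?size_tuple ?leq_subr// !drop_drop addnC.
Qed.

(** Both sides are the first [D - Dt + 1] entries of [rcons t a]; [Dt < D] makes [t] nonempty, so
    that [head] really reads its oldest action. *)
Lemma take_shift_buf (t : D.-tuple A) a : (Dt < D)%N ->
  head a t :: take (D - Dt) (shift_buf t a) =
  take (D - Dt) t ++ [:: head a (last_buf hD t)].
Proof.
move=> ltD; have st := size_tuple t.
have -> : head a t :: take (D - Dt) (shift_buf t a) = take (D - Dt).+1 (rcons t a).
  rewrite /=; case: (tval t) st => [/= st|b s _ //=].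
  by rewrite -st in ltD.
rewrite (take_nth a) ?size_rcons ?st ?ltnS ?leq_subr// -cats1.
congr (_ ++ [:: _]); first by rewrite -cats1 takel_cat// st leq_subr.
rewrite val_last_buf -nth0 nth_drop addn0 nth_rcons st.
(* The remaining case is [Dt = 0]: the entry in question is the appended action, and [head] of the
   empty short buffer also defaults to [a]. *)
case: ltnP => // le; rewrite nth_default ?st//; last by case: eqP.
Qed.

Lemma measurable_last_buf : measurable_fun setT (fun t : D.-tuple A => last_buf hD t).
Proof.
apply/measurable_fun_tnthP => i.
rewrite (_ : _ \o _ = fun t => tnth t (Ordinal (belief_idx_proof hD i))).
  exact: measurable_tnth.
by apply/funext => t /=; rewrite tnth_mktuple.
Qed.

Definition beliefR (g : Xt S A Dt -> R) (x : Xt S A D) : R :=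
  rollR P (fun s => g (s, last_buf hD x.2)) x.1 (take (D - Dt) x.2).

Lemma bm_belief_section (g : Xt S A Dt -> R) t : bm g -> bm (fun s => g (s, t)).
Proof. by move=> bg; exact: (bm_comp (phi := pair^~ t) _ bg). Qed.

Lemma beliefE_EFin (g : Xt S A Dt -> R) x : bm g ->
  beliefE P hD (fun y => (g y)%:E) x = (beliefR g x)%:E.
Proof. by move=> bg; rewrite /beliefE rollE_EFin//; exact: bm_belief_section. Qed.

Lemma le_beliefE (f g : Xt S A Dt -> \bar R) x : (forall y, f y <= g y)%E ->
  (beliefE P hD f x <= beliefE P hD g x)%E.
Proof. by move=> fg; apply: le_rollE. Qed.

Lemma bm_beliefR_param (h : Xt S A Dt -> A -> R) :
  bm (fun p => h p.1 p.2) ->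
  bm (fun p : Xt S A D * A => beliefR (fun y => h y p.2) p.1).
Proof.
move=> bh.
have := @bm_rollR_buf _ _ _ _ _ P D (D - Dt) _ _
  (fun q : (Xt S A D * A) * S => h (q.2, last_buf hD q.1.1.2) q.1.2)
  (fun p => p.1.1) (fun p => p.1.2).
apply.
- apply: (bm_comp (phi := fun q : Xt S A D * A * S =>
    ((q.2, last_buf hD q.1.1.2), q.1.2))) bh.
  apply: measurable_fun_pair; last exact: measurableT_comp.
  apply: measurable_fun_pair => //.
  apply: (measurableT_comp (f := fun t : D.-tuple A => last_buf hD t)).
    exact: measurable_last_buf.
  by apply: measurableT_comp => //; exact: measurableT_comp.
- exact: measurableT_comp.
- exact: measurableT_comp.
Qed.

Lemma bm_beliefR (g : Xt S A Dt -> R) : bm g -> bm (beliefR g).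
Proof.
move=> bg; have := @bm_beliefR_param (fun y _ => g y).
move=> /(_ (bm_comp measurable_fst bg)) bb.
exact: (bm_comp (pair2_measurable point) bb).
Qed.

Lemma beliefRB (g1 g2 : Xt S A Dt -> R) x : bm g1 -> bm g2 ->
  beliefR (fun y => g1 y - g2 y) x = beliefR g1 x - beliefR g2 x.
Proof. by move=> b1 b2; rewrite /beliefR rollRB//; exact: bm_belief_section. Qed.

Lemma beliefRD (g1 g2 : Xt S A Dt -> R) x : bm g1 -> bm g2 ->
  beliefR (fun y => g1 y + g2 y) x = beliefR g1 x + beliefR g2 x.
Proof. by move=> b1 b2; rewrite /beliefR rollRD//; exact: bm_belief_section. Qed.

Lemma beliefRZ c (g : Xt S A Dt -> R) x : bm g ->
  beliefR (fun y => c * g y) x = c * beliefR g x.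
Proof. by move=> b; rewrite /beliefR rollRZ//; exact: bm_belief_section. Qed.

Lemma beliefR_swap d3 (Z : measurableType d3) (k : R.-pker Z ~> A) z
    (h : Xt S A Dt -> A -> R) x :
  bm (fun p => h p.1 p.2) ->
  \int[k z]_a beliefR (h ^~ a) x = beliefR (fun y => \int[k z]_a h y a) x.
Proof.
move=> bh; apply: (rollR_swap P k z (h := fun p => h (p.2, last_buf hD x.2) p.1)).
apply: (bm_comp (phi := fun p : A * S => ((p.2, last_buf hD x.2), p.1))) bh.
by apply: measurable_fun_pair => //; exact: measurable_fun_pair.
Qed.

(** Rolling the first [D - Dt] actions and then the last [Dt] is rolling the whole buffer. *)
Lemma beliefR_reward (Rw : S * A -> R) x a :
  beliefR (fun y => rewardR P Rw y a) x = rewardR P Rw x a.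
Proof.
by rewrite /beliefR /rewardR /= val_last_buf -rollR_cat cat_take_drop.
Qed.

(** Either order rolls the state through the same [D - Dt + 1] actions, by [take_shift_buf], and
    ends with the same short buffer, by [last_buf_shift]. *)
Lemma beliefR_step (g : Xt S A Dt -> R) x a : (Dt < D)%N ->
  beliefR (fun y => stepR P g y a) x = stepR P (beliefR g) x a.
Proof.
move=> ltD; rewrite /beliefR /stepR /=.
transitivity (rollR P (fun s => g (s, shift_buf (last_buf hD x.2) a)) x.1
    (take (D - Dt) x.2 ++ [:: head a (last_buf hD x.2)])).
  by rewrite rollR_cat.
by rewrite -take_shift_buf//= last_buf_shift.
Qed.

End Belief.

(** * Bounds on the Wasserstein distance *)

Section Wasserstein.
Context {R : realType} {d} {A : measurableType d}.
Variables (dA : A -> A -> R) (mu nu : {measure set A -> \bar R}).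
Hypotheses (mu1 : mu setT = 1%E) (nu1 : nu setT = 1%E).

Lemma W1_ge0 : (forall a b, 0 <= dA a b) -> (0 <= W1 dA mu nu)%E.
Proof.
move=> dA0; apply: le_ereal_inf_tmp => _ [c _ <-].
by apply: integral_ge0 => p _; rewrite lee_fin.
Qed.

(** For each coupling [c] the difference of means is the [c]-mean of [phi p.1 - phi p.2], which lies
    pointwise below the cost. *)
Lemma kantorovich_le_W1 (phi : A -> R) : bm phi ->
  (forall a b, phi a - phi b <= dA a b) ->
  ((\int[mu]_a phi a - \int[nu]_a phi a)%:E <= W1 dA mu nu)%E.
Proof.
move=> bphi phid; apply: le_ereal_inf_tmp => _ [c cc <-].
have c1 : c setT = 1%E by exact: probability_setT.
have b1 : bm (fun p : A * A => phi p.1) by exact: (bm_comp measurable_fst bphi).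
have b2 : bm (fun p : A * A => phi p.2) by exact: (bm_comp measurable_snd bphi).
(* The first marginal condition says that [mu] is the push-forward of [c] under [fst]. *)
have E1 : \int[mu]_a phi a = \int[c]_p phi p.1.
  apply: EFin_inj; rewrite -(mean_EFin mu1)// -(mean_EFin c1)//.
  rewrite -(@integral_pushforward _ _ _ _ _ _ measurable_fst c setT (EFin \o phi))//.
  - apply: eq_measure_integral => B mB _ /=; rewrite /pushforward.
    by have [<- _] := cc B mB; congr (c _); apply/seteqP; split => p /=; tauto.
  - by apply/measurable_EFinP; case: bphi.
  - exact: (bm_integrable c1 b1).
have E2 : \int[nu]_a phi a = \int[c]_p phi p.2.
  apply: EFin_inj; rewrite -(mean_EFin nu1)// -(mean_EFin c1)//.
  rewrite -(@integral_pushforward _ _ _ _ _ _ measurable_snd c setT (EFin \o phi))//.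
  - apply: eq_measure_integral => B mB _ /=; rewrite /pushforward.
    by have [_ <-] := cc B mB; congr (c _); apply/seteqP; split => p /=; tauto.
  - by apply/measurable_EFinP; case: bphi.
  - exact: (bm_integrable c1 b2).
rewrite E1 E2 -(meanB c1)// -(mean_EFin c1); last exact: bmB.
by apply: le_integral_pointwise => p; rewrite lee_fin.
Qed.

Lemma W1_0 : (forall a b, dA a b = 0) -> W1 dA mu nu = 0%E.
Proof.
move=> dA0; rewrite /W1 -[RHS]ereal_inf1; congr ereal_inf.
have I0 (c : probability (A * A)%type R) : (\int[c]_p (dA p.1 p.2)%:E = 0)%E.
  by apply: integral0_eq => p _; rewrite dA0.
apply/seteqP; split => [_ [c _ <-]//|_ ->].
(* The product coupling shows that the infimum is not over the empty set, where it would be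
   infinite. *)
exists (asprob mu1 \x asprob nu1)%E; last exact: I0.
move=> B mB; split.
  transitivity (mu B * nu setT)%E; last by rewrite nu1 mule1.
  exact: (product_measure1E (asprob mu1) (asprob nu1)).
transitivity (mu setT * nu B)%E; last by rewrite mu1 mul1e.
exact: (product_measure1E (asprob mu1) (asprob nu1)).
Qed.

End Wasserstein.

(** * The policy transition operator and discounted occupancy *)

Section Occupancy.
Context {R : realType} {d1 d2} {S : measurableType d1} {A : measurableType d2}.
Variables (P : R.-pker (S * A) ~> S) (gamma : R) (n : nat).
Hypothesis gamma01 : 0 < gamma < 1.
Variable pi : R.-pker (Xt S A n) ~> A.

(** The operator U of the overview, on real functions; [polStep] is its extended-real form. *)
Definition polR (g : Xt S A n -> R) := avgR pi (stepR P g).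

Lemma bm_polR g : bm g -> bm (polR g).
Proof. by move=> bg; apply: bm_avgR; exact: bm_stepR. Qed.

Lemma bm_iter_polR i g : bm g -> bm (iter i polR g).
Proof. by move=> bg; elim: i => // i IH; rewrite iterS; exact: bm_polR. Qed.

Lemma polRD c f g : bm f -> bm g ->
  polR (fun x => f x + c * g x) = fun x => polR f x + c * polR g x.
Proof.
move=> bf bg; apply/funext => x; rewrite -avgRZ; last exact: bm_stepR.
rewrite -avgRD; [|exact: bm_stepR|exact/bmZl/bm_stepR].
congr (avgR _ _ _); apply/funext => y; apply/funext => a.
by rewrite stepRD ?stepRZ//; exact: bmZl.
Qed.

Lemma iter_polRD i c f g : bm f -> bm g ->
  iter i polR (fun x => f x + c * g x) =
  fun x => iter i polR f x + c * iter i polR g x.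
Proof.
move=> bf bg; elim: i => // i IH.
by rewrite !iterS IH polRD//; exact: bm_iter_polR.
Qed.

Lemma polR_bound g M x : bm g -> (forall y, `|g y| <= M) -> `|polR g x| <= M.
Proof.
move=> bg gM; apply: avgR_bound; first exact: bm_stepR.
by move=> y a; exact: stepR_bound.
Qed.

Lemma polStep_EFin g x : bm g -> polStep P pi (EFin \o g) x = (polR g x)%:E.
Proof.
move=> bg; rewrite /polStep; under eq_integral do rewrite stepE_EFin//.
rewrite (mean_EFin (pker1 _ _))//.
by apply: (bm_section (h := stepR P g)); exact: bm_stepR.
Qed.

Lemma iter_polStep_EFin i g : bm g ->
  iter i (polStep P pi) (EFin \o g) = EFin \o iter i polR g.
Proof.
move=> bg; elim: i => // i IH; rewrite !iterS IH.
by apply/funext => x; rewrite polStep_EFin//; exact: bm_iter_polR.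
Qed.

Lemma le_polStep (f g : Xt S A n -> \bar R) x : (forall y, f y <= g y)%E ->
  (polStep P pi f x <= polStep P pi g x)%E.
Proof.
by move=> fg; apply: le_integral_pointwise => a; apply: le_integral_pointwise.
Qed.

Lemma le_iter_polStep i (f g : Xt S A n -> \bar R) x : (forall y, f y <= g y)%E ->
  (iter i (polStep P pi) f x <= iter i (polStep P pi) g x)%E.
Proof. by move=> fg; elim: i x => // i IH x; rewrite !iterS; exact: le_polStep. Qed.

Lemma polStep0 : polStep P pi (fun=> 0%E) = fun=> 0%E.
Proof.
by apply/funext => x; rewrite /polStep /stepE integral0_eq// => a _; rewrite integral0.
Qed.

Lemma iter_polStep0 i : iter i (polStep P pi) (fun=> 0%E) = fun=> 0%E.
Proof. by elim: i => // i IH; rewrite iterS IH polStep0. Qed.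

Lemma occE0 x : occE P gamma pi (fun=> 0%E) x = 0%E.
Proof.
rewrite /occE eseries0 ?mule0// => i _ _.
by rewrite iter_polStep0 mule0.
Qed.

Lemma iter_polStep_ge0 i (g : Xt S A n -> \bar R) x : (forall y, 0 <= g y)%E ->
  (0 <= iter i (polStep P pi) g x)%E.
Proof.
move=> g0; have -> : 0%E = iter i (polStep P pi) (fun=> 0%E) x.
  by rewrite iter_polStep0.
exact: le_iter_polStep.
Qed.

(** Unrolling the recursion [m] times leaves a remainder of size at most [M * gamma ^+ m].
    Monotonicity replaces [f] by [g] in each summand, and nonnegativity of [g] bounds the partial
    sums by the full series. *)
Lemma le_occE (J f : Xt S A n -> R) (g : Xt S A n -> \bar R) : bm J -> bm f ->
  (forall x, J x = f x + gamma * polR J x) ->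
  (forall x, 0 <= g x)%E -> (forall x, (f x)%:E <= g x)%E ->
  forall x, (((1 - gamma) * J x)%:E <= occE P gamma pi g x)%E.
Proof.
move=> bJ bf JE g0 fg x; have /andP[gam0 gam1] := gamma01.
rewrite /occE EFinM lee_wpmul2l//; first by rewrite lee_fin subr_ge0 ltW.
have [M JM] := bJ.2.
have UJM i y : `|iter i polR J y| <= M.
  elim: i y => // i IH y; rewrite iterS; apply: polR_bound => //.
  exact: bm_iter_polR.
have unroll m y : J y = \sum_(0 <= i < m) gamma ^+ i * iter i polR f y
    + gamma ^+ m * iter m polR J y.
  elim: m => [|m IH]; first by rewrite big_geq// add0r expr0 mul1r.
  rewrite {1}IH big_nat_recr//= -addrA; congr (_ + _).
  rewrite {1}(_ : J = fun z => f z + gamma * polR J z); last exact/funext.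
  rewrite iter_polRD//; last exact: bm_polR.
  by rewrite -iterSr iterS exprSr mulrDr mulrA.
set K := (X in (_ <= X)%E).
have term0 i : (0 <= (gamma ^+ i)%:E * iter i (polStep P pi) g x)%E.
  by rewrite mule_ge0 ?lee_fin ?exprn_ge0 ?(ltW gam0)//; exact: iter_polStep_ge0.
have JK m : ((J x)%:E <= K + (M * gamma ^+ m)%:E)%E.
  rewrite (unroll m x) EFinD; apply: leeD.
    apply: (@le_trans _ _ (\sum_(0 <= i < m)
        (gamma ^+ i)%:E * iter i (polStep P pi) g x)%E); last first.
      by apply: nneseries_lim_ge => i _ _; exact: term0.
    rewrite -sumEFin; apply: lee_sum => i _; rewrite EFinM lee_wpmul2l//.
      by rewrite lee_fin exprn_ge0// ltW.
    have /(congr1 (fun F => F x)) /= <- := iter_polStep_EFin i bf.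
    exact: le_iter_polStep.
  rewrite lee_fin mulrC ler_wpM2r ?exprn_ge0 ?(ltW gam0)//.
  exact: le_trans (ler_norm _) (UJM _ _).
have K0 : (0 <= K)%E by apply: nneseries_ge0 => i _ _; exact: term0.
(* An infinite series makes the bound trivial; a finite one allows subtraction and the limit in
   [m]. *)
case: K K0 JK => [k| |]// _ JK; last by rewrite leey.
rewrite lee_fin -subr_le0; apply: (le0_geometric gamma01 (C := M)) => m.
by rewrite lerBlDl -lee_fin EFinD.
Qed.

End Occupancy.

(** * Performance difference between the two delayed tasks *)

Section PerformanceDifference.
Context {R : realType} {d1 d2} {S : measurableType d1} {A : measurableType d2}.
Variables (P : R.-pker (S * A) ~> S) (Rw : S * A -> R) (gamma : R).
Hypotheses (bRw : bm Rw) (gamma01 : 0 < gamma < 1).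
Variables (D Dt : nat) (hD : (Dt < D)%N).
Variables (pi : R.-pker (Xt S A D) ~> A) (piT : R.-pker (Xt S A Dt) ~> A).

Let Q := QR P Rw gamma pi.
Let QT := QR P Rw gamma piT.

Definition beliefQ (x : Xt S A D) a := beliefR P (ltnW hD) (QT ^~ a) x.
(** The J of the overview; [policy_gap] is its f, with the belief and [pi] averaged in the other
    order until [policy_gapE] exchanges them. *)
Definition value_gap (x : Xt S A D) :=
  beliefR P (ltnW hD) (avgR piT QT) x - avgR pi Q x.
Definition policy_gap (x : Xt S A D) :=
  beliefR P (ltnW hD) (avgR piT QT) x - avgR pi beliefQ x.

Let bmQ : bm (fun p => Q p.1 p.2) := bm_QR P bRw gamma01 pi.
Let bmQT : bm (fun p => QT p.1 p.2) := bm_QR P bRw gamma01 piT.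

Lemma bm_beliefQ : bm (fun p => beliefQ p.1 p.2).
Proof. exact: bm_beliefR_param. Qed.

Lemma bm_value_gap : bm value_gap.
Proof. by apply: bmB; [apply: bm_beliefR|]; exact: bm_avgR. Qed.

Lemma bm_policy_gap : bm policy_gap.
Proof.
by apply: bmB; [apply: bm_beliefR|]; apply: bm_avgR => //; exact: bm_beliefQ.
Qed.

(** Both Q-functions are expanded by [bellman]. The belief average of the auxiliary reward is the
    delayed reward, so the rewards cancel, and [beliefR_step] collects the rest into one step of
    [value_gap]. *)
Lemma beliefQ_sub_Q x a :
  beliefQ x a - Q x a = gamma * stepR P value_gap x a.
Proof.
have bVT : bm (avgR piT QT) by exact: bm_avgR.
have bV : bm (avgR pi Q) by exact: bm_avgR.
rewrite stepRB//; last exact: bm_beliefR.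
rewrite -beliefR_step// mulrBr /Q bellman//.
rewrite -[nextR P pi _ x a]/(stepR P (avgR pi Q) x a).
suff -> : beliefQ x a = rewardR P Rw x a
    + gamma * beliefR P (ltnW hD) ((stepR P (avgR piT QT)) ^~ a) x by lra.
rewrite -(beliefR_reward P (ltnW hD)).
have bs : bm (fun y => stepR P (avgR piT QT) y a).
  by apply: (bm_comp (pair2_measurable a)) (bm_stepR P bVT).
have br : bm (fun y : Xt S A Dt => rewardR P Rw y a).
  exact: (bm_comp (pair2_measurable a) (bm_rewardR P bRw Dt)).
rewrite -beliefRZ// -beliefRD//; last exact: bmZl.
by congr (beliefR _ _ _ _); apply/funext => y; rewrite /QT bellman.
Qed.

Lemma value_gapE x : value_gap x = policy_gap x + gamma * polR P pi value_gap x.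
Proof.
have bJ := bm_value_gap.
rewrite /polR -avgRZ; last exact: bm_stepR.
rewrite (_ : (fun _ => _) = fun y a => beliefQ y a - Q y a); last first.
  by apply/funext => y; apply/funext => a; rewrite beliefQ_sub_Q.
by rewrite avgRB//; [rewrite /policy_gap /value_gap; lra|exact: bm_beliefQ].
Qed.

Lemma policy_gapE x : policy_gap x =
  beliefR P (ltnW hD) (fun y => avgR piT QT y - \int[pi x]_a QT y a) x.
Proof.
rewrite /policy_gap {2}/avgR beliefR_swap// -beliefRB//; first exact: bm_avgR.
apply: (bm_mean pi (phi := fun=> x) _ (h := fun p => QT p.1 p.2)) => //.
Qed.

(** The integrand is real-valued, bounded and measurable, so the left-hand side of the theorem can
    be computed exactly. *)
Lemma integral_belief_gap x :
  (\int[pi x]_a beliefE P (ltnW hD)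
      (fun y => Qfun P Rw gamma piT y a - Qfun P Rw gamma pi x a) x =
   (gamma * polR P pi value_gap x)%:E)%E.
Proof.
have bJ := bm_value_gap.
transitivity (\int[pi x]_a (gamma * stepR P value_gap x a)%:E)%E; last first.
  rewrite (mean_EFin (pker1 _ _)).
    by rewrite (meanZl (pker1 _ _))//; apply: bm_section; exact: bm_stepR.
  by apply: bmZl; apply: (bm_section (h := stepR P value_gap)); exact: bm_stepR.
apply: eq_integral => a _; rewrite -beliefQ_sub_Q.
have bQTa : bm (QT ^~ a) by exact: (bm_comp (pair2_measurable a) bmQT).
rewrite (_ : (fun _ => _) = fun y => (QT y a - Q x a)%:E); last first.
  by apply/funext => y; rewrite !Qfun_EFin.
rewrite beliefE_EFin; last by apply: bmB => //; exact: bm_cst.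
rewrite beliefRB//; last exact: bm_cst.
by rewrite /beliefR rollR_cst.
Qed.

End PerformanceDifference.

Theorem mainTheorem3 (R : realType) (d1 d2 : measure_display)
    (S : measurableType d1) (A : measurableType d2) (dA : A -> A -> R)
    (P : R.-pker (S * A) ~> S) (Rw : S * A -> R) (gamma : R)
    (D Dt : nat) (hD : (Dt < D)%N)
    (pi : R.-pker (Xt S A D) ~> A) (piT : R.-pker (Xt S A Dt) ~> A) (LQ : R) :
  is_metric dA ->
  measurable_fun setT Rw ->
  (exists M : R, forall z, `|Rw z| <= M) ->
  0 < gamma < 1 ->
  (forall (xt : Xt S A Dt) (a1 a2 : A),
      (`|Qfun P Rw gamma piT xt a1 - Qfun P Rw gamma piT xt a2|
         <= (LQ * dA a1 a2)%:E)%E) ->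
  forall x : Xt S A D,
  (\int[pi x]_a
      beliefE P (ltnW hD)
        (fun xt => Qfun P Rw gamma piT xt a - Qfun P Rw gamma pi x a) x
   <= (gamma * LQ / (1 - gamma))%:E *
      \int[pi x]_a
        stepE P
          (occE P gamma pi
             (fun xh => beliefE P (ltnW hD)
                          (fun xht => W1 dA (piT xht) (pi xh)) xh)) x a)%E.
Proof.
move=> [dA0 _ _ _] mRw bRw' gamma01 lipE x.
have bRw : bm Rw by split.
have /andP[gam0 gam1] := gamma01.
have [J0 f0] := (bm_value_gap P bRw gamma01 hD pi piT,
  bm_policy_gap P bRw gamma01 hD pi piT).
set J := value_gap _ _ _ _ _ _ in J0.
set f := policy_gap _ _ _ _ _ _ in f0.
have JE : forall y, J y = f y + gamma * polR P pi J y by exact: value_gapE.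
rewrite integral_belief_gap// -/J.
set QT := QR P Rw gamma piT.
have bQT : bm (fun p => QT p.1 p.2) by exact: bm_QR.
have lip xt a1 a2 : `|QT xt a1 - QT xt a2| <= LQ * dA a1 a2.
  by have := lipE xt a1 a2; rewrite !Qfun_EFin.
set g := (fun xh => beliefE _ _ _ _).
have bg y : bm (fun xt => avgR piT QT xt - \int[pi y]_a QT xt a).
  apply: bmB; first exact: bm_avgR.
  exact: (bm_mean pi (phi := fun=> y) _ (h := fun p => QT p.1 p.2)).
have [LQ0|LQ0] := ltP 0 LQ.
  have g0 y : (0 <= g y)%E.
    have -> : 0%E = beliefE P (ltnW hD) (fun=> 0%E) y.
      by rewrite (beliefE_EFin _ _ _ (bm_cst 0)) /beliefR rollR_cst.
    by apply: le_beliefE => xt; exact: W1_ge0.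
  (* Divided by [LQ], the function [QT xt] is 1-Lipschitz, as the Kantorovich bound requires. *)
  have fg y : ((LQ^-1 * f y)%:E <= g y)%E.
    rewrite /f policy_gapE// -beliefRZ// -beliefE_EFin; last exact: bmZl.
    apply: le_beliefE => xt.
    have bphi : bm (QT xt) by exact: bm_section.
    rewrite mulrBr -(meanZl (pker1 _ _) _ bphi) -(meanZl (pker1 _ _) _ bphi).
    apply: kantorovich_le_W1; [exact: pker1|exact: pker1|exact: bmZl|].
    move=> a b; rewrite -mulrBr ler_pdivrMl//.
    exact: le_trans (ler_norm _) (lip _ _ _).
  have occ := le_occE gamma01 (bmZl LQ^-1 J0) (bmZl LQ^-1 f0) _ g0 fg.
  have polRZ c h y : bm h -> polR P pi (fun z => c * h z) y = c * polR P pi h y.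
    move=> bh; rewrite /polR -avgRZ; last exact: bm_stepR.
    by congr (avgR _ _ _); apply/funext => z; apply/funext => a; rewrite stepRZ.
  (* The factors [1 - gamma] and [LQ^-1] are moved under the operator, giving exactly the function
     that [occ] bounds; their inverses form the constant of the theorem. *)
  rewrite (_ : gamma * polR P pi J x = gamma * LQ / (1 - gamma) *
    polR P pi (fun y => (1 - gamma) * (LQ^-1 * J y)) x); last first.
    rewrite !polRZ//; last exact: bmZl.
    by field; rewrite gt_eqF//= subr_eq0 gt_eqF.
  rewrite EFinM lee_wpmul2l//.
    by rewrite lee_fin divr_ge0 ?subr_ge0 ?mulr_ge0// ltW.
  rewrite -polStep_EFin; last by do 2 apply: bmZl.
  (* The integral on the right is by definition [polStep] of the occupancy expectation. What [occ]
     still asks for is the recursion for [J] divided by [LQ]. *)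
  apply: le_polStep => y; apply: occ => z.
  by rewrite polRZ// JE mulrDr !mulrA (mulrC gamma).
(* For LQ <= 0 both sides are trivial: Q^tau does not depend on the action, and
   LQ < 0 moreover forces dA = 0. *)
have QTcst xt a b : QT xt a = QT xt b.
  apply/eqP; rewrite -subr_eq0 -normr_le0 (le_trans (lip _ _ _))//.
  by rewrite mulr_le0_ge0.
have f_eq0 y : f y = 0.
  rewrite /f policy_gapE// (_ : (fun _ => _) = fun=> 0); last first.
    apply/funext => xt; rewrite /avgR.
    rewrite (_ : QR _ _ _ _ xt = fun=> QT xt point); last first.
      by apply/funext => a; exact: QTcst.
    by rewrite !(mean_cst (pker1 _ _)) subrr.
  by rewrite /beliefR rollR_cst.
(* With [f] zero, [le_occE] applies with [g] the zero function, whose occupancy expectation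
   vanishes. *)
have J_le0 y : J y <= 0.
  rewrite -(@pmulr_rle0 _ (1 - gamma)) ?subr_gt0// -lee_fin.
  rewrite -[leRHS](occE0 P gamma pi y).
  by apply: (le_occE gamma01 J0 f0 JE) => // z; rewrite f_eq0.
have polJ_le0 : polR P pi J x <= 0.
  rewrite -lee_fin -polStep_EFin//.
  have -> : 0%:E = polStep P pi (fun=> 0%E) x by rewrite polStep0.
  by apply: le_polStep => y; rewrite lee_fin.
apply: (@le_trans _ _ 0%E); first by rewrite lee_fin mulr_ge0_le0// ltW.
(* For [LQ = 0] the product on the right is 0 even if the integral is infinite. *)
have [->|LQn0] := eqVneq LQ 0; first by rewrite mulr0 mul0r mul0e.
have dA_eq0 a b : dA a b = 0.
  apply/eqP; rewrite eq_le dA0 andbT -(@nmulr_rge0 _ LQ) ?lt_neqAle ?LQn0//.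
  exact: le_trans (normr_ge0 _) (lip (point : Xt S A Dt) a b).
rewrite (_ : g = fun=> 0%E); last first.
  apply/funext => y; rewrite /g (_ : (fun _ => _) = fun=> 0%E); last first.
    by apply/funext => xt; apply: W1_0 => //; exact: pker1.
  by rewrite (beliefE_EFin _ _ _ (bm_cst 0)) /beliefR rollR_cst.
rewrite (_ : occE _ _ _ _ = fun=> 0%E); last by apply/funext => y; rewrite occE0.
by rewrite -[X in (_ * X)%E]/(polStep P pi (fun=> 0%E) x) polStep0 mule0.
Qed.
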